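(* Let $p,n\ge 1$, let $x_1,\dots,x_k\in\mathbb{R}$ be distinct points and let $m_1,\dots,m_k\ge 1$ be integers (the multiplicities of the points) with $\sum_{i=1}^k m_i=np$. For each $i$ let $v_{i,1},\dots,v_{i,m_i}\in\mathbb{R}^p$ be non-zero, linearly independent column vectors. Put $$X=(v_{1,1}\ \cdots\ v_{1,m_1}\ \cdots\ v_{k,1}\ \cdots\ v_{k,m_k})\in\mathbb{R}^{p\times np},\qquad J=\mathrm{diag}(\underbrace{x_1,\dots,x_1}_{m_1},\dots,\underbrace{x_k,\dots,x_k}_{m_k})\in\mathbb{R}^{np\times np},$$ and assume that the $np\times np$ matrix $\mathrm{col}(XJ^l)_{l=0}^{n-1}$ is non-singular. Let $F$ be a $p\times p$ real matrix-valued function (defined at the points $x_i$). Then the interpolation matrix polynomial of the Lagrange interpolation problem, i.e. the matrix polynomial $P(x)=A_{n-1}x^{n-1}+\dots+A_1x+A_0$ with $A_j\in\mathbb{R}^{p\times p}$ satisfying $$P(x_i)\,v_{i,j}=F(x_i)\,v_{i,j},\qquad j=1,\dots,m_i,\quad i=1,\dots,k,$$ is given by $$P(x)=\sum_{i=1}^k F(x_i)\,(0\ \cdots\ 0\ v_{i,1}\ \cdots\ v_{i,m_i}\ 0\ \cdots\ 0)\,(V_1+V_2x+\dots+V_nx^{n-1}),$$ where the $p\times np$ matrix $(0\ \cdots\ 0\ v_{i,1}\ \cdots\ v_{i,m_i}\ 0\ \cdots\ 0)$ has $m_1+\dots+m_{i-1}$ zero columns before $v_{i,1}$ and $m_{i+1}+\dots+m_k$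 zero columns after $v_{i,m_i}$, and where the $np\times p$ matrices $V_1,\dots,V_n$ are defined by $$(V_1\ V_2\ \cdots\ V_n)=\left(\mathrm{col}(XJ^l)_{l=0}^{n-1}\right)^{-1}.$$
   Context: For $X$ of size $p\times np$ and $J$ of size $np\times np$, $\mathrm{col}(XJ^l)_{l=0}^{n-1}$ denotes the $np\times np$ matrix obtained by stacking $X, XJ, XJ^2,\dots,XJ^{n-1}$ vertically (in this order from top to bottom). *)

(* Defs.v *)
From mathcomp Require Export all_boot all_order all_algebra.
From mathcomp Require Export reals.

Set Implicit Arguments.
Unset Strict Implicit.
Unset Printing Implicit Defensive.

Import GRing.Theory.
Local Open Scope ring_scope.

Lemma sum_const_ord (n p : nat) : (\sum_(l < n) p = n * p)%N.
Proof. by rewrite sum_nat_const card_ord. Qed.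

Definition col_XJ (R : realType) (p n : nat)
    (X : 'M[R]_(p, n * p)) (J : 'M[R]_(n * p)) : 'M[R]_(n * p) :=
  castmx (sum_const_ord n p, erefl) (\mxcol_(l < n) (X *m J ^+ l)).

Section LagrangeData.
Variables (R : realType) (p n k : nat) (m : 'I_k -> nat).
Variables (x : 'I_k -> R) (v : forall i, 'I_(m i) -> 'cV[R]_p).
Hypothesis sum_m : (\sum_(i < k) m i = n * p)%N.

Definition node_mx (i : 'I_k) : 'M[R]_(p, m i) := \matrix_(r, j) v j r 0.

Definition lagrange_X : 'M[R]_(p, n * p) :=
  castmx (erefl, sum_m) (\mxrow_(i < k) node_mx i).

Definition lagrange_J : 'M[R]_(n * p) :=
  castmx (sum_m, sum_m) (\mxdiag_(i < k) (x i)%:M).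

(* (0 ... 0 v_{i,1} ... v_{i,m_i} 0 ... 0) *)
Definition lagrange_block (i : 'I_k) : 'M[R]_(p, n * p) :=
  castmx (erefl, sum_m) (\mxrow_(i' < k) (if i' == i then node_mx i' else 0)).

Definition lagrange_col : 'M[R]_(n * p) := col_XJ lagrange_X lagrange_J.

(* [lagrange_V l] is V_(l+1): ordinals start at 0, the V's at 1. *)
Definition lagrange_V (l : 'I_n) : 'M[R]_(n * p, p) :=
  submxrow (castmx (erefl, esym (sum_const_ord n p)) (invmx lagrange_col)) l.

Lemma lagrange_VE :
  castmx (erefl, sum_const_ord n p) (\mxrow_(l < n) lagrange_V l)
    = invmx lagrange_col.
Proof. by rewrite submxrowK castmx_comp castmx_id. Qed.

End LagrangeData.

Definition matpoly (R : realType) (a b n : nat) (A : 'I_n -> 'M[R]_(a, b)) :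
    'M[{poly R}]_(a, b) :=
  \sum_(l < n) 'X^l *: map_mx polyC (A l).

Definition matpoly_eval (R : realType) (a b : nat) (P : 'M[{poly R}]_(a, b))
    (t : R) : 'M[R]_(a, b) :=
  map_mx (fun q : {poly R} => q.[t]) P.

Definition is_lagrange_interpolant (R : realType) (p n k : nat)
    (m : 'I_k -> nat) (x : 'I_k -> R) (v : forall i, 'I_(m i) -> 'cV[R]_p)
    (F : R -> 'M[R]_p) (P : 'M[{poly R}]_p) : Prop :=
  (exists A : 'I_n -> 'M[R]_p, P = matpoly A) /\
  (forall (i : 'I_k) (j : 'I_(m i)),
     matpoly_eval P (x i) *m v i j = F (x i) *m v i j).

(* Main.v *)
(** Let [C = col(X J^l)] and [A = (A_0 ... A_(n-1))].  The column of [A C] indexed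
    by [(i, j)] is [sum_l x_i^l A_l v_ij = P(x_i) v_ij], while the corresponding
    column of [W = sum_i F(x_i) (0 ... v_i1 ... v_im_i ... 0)] is [F(x_i) v_ij].
    So the interpolation conditions amount to [A C = W], that is
    [A = W C^-1 = (W V_1 ... W V_n)]. *)

Require Import Defs.

Import GRing.Theory.
Local Open Scope ring_scope.

Lemma castmx_mul_inner (R : pzSemiRingType) (a b N N' : nat) (e : N = N')
    (A : 'M[R]_(a, N)) (B : 'M[R]_(N, b)) :
  castmx (erefl, e) A *m castmx (e, erefl) B = A *m B.
Proof. by case: N' / e; rewrite !castmx_id. Qed.

Lemma castmx_row_mul (R : pzSemiRingType) (a b N N' : nat) (e : N = N')
    (A : 'M[R]_(a, b)) (B : 'M[R]_(b, N)) :
  castmx (erefl, e) (A *m B) = A *m castmx (erefl, e) B.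
Proof. by case: N' / e; rewrite !castmx_id. Qed.

Lemma matpoly_eval_matpoly (R : realType) (a b n : nat)
    (A : 'I_n -> 'M[R]_(a, b)) (t : R) :
  matpoly_eval (matpoly A) t = \sum_(l < n) t ^+ l *: A l.
Proof.
apply/matrixP => i j; rewrite mxE !summxE horner_sum.
by apply: eq_bigr => l _; rewrite !mxE hornerM hornerXn hornerC.
Qed.

Lemma mulmx_matpoly (R : realType) (a b c n : nat) (W : 'M[R]_(a, b))
    (B : 'I_n -> 'M[R]_(b, c)) :
  map_mx polyC W *m matpoly B = matpoly (fun l => W *m B l).
Proof.
rewrite /matpoly mulmx_sumr; apply: eq_bigr => l _.
by rewrite -scalemxAr map_mxM.
Qed.

Lemma eq_matpoly (R : realType) (a b n : nat) (A B : 'I_n -> 'M[R]_(a, b)) :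
  A =1 B -> matpoly A = matpoly B.
Proof. by move=> eqAB; apply: eq_bigr => l _; rewrite eqAB. Qed.

Section BlockBasis.
Variables (R : realType) (p n k : nat) (m : 'I_k -> nat).
Variables (x : 'I_k -> R) (v : forall i, 'I_(m i) -> 'cV[R]_p).
Hypothesis sum_m : (\sum_(i < k) m i = n * p)%N.

(** Standard basis vector of the coordinate that the pair [(i, j)] occupies in the block
    decomposition. Multiplying by it picks a column, so the casts stay hidden in the lemmas
    below. *)
Definition block_basis (i : 'I_k) (j : 'I_(m i)) : 'cV[R]_(n * p) :=
  delta_mx (cast_ord sum_m (tagnat.Rank i j)) 0.

(** Every column index [s] is the rank of a unique pair [(i, j)], so these vectors exhaust the
    standard basis. *)
Lemma mulmx_block_basis_inj (a : nat) (M M' : 'M[R]_(a, n * p)) :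
  (forall i j, M *m block_basis i j = M' *m block_basis i j) -> M = M'.
Proof.
move=> eqM; apply/matrixP => r s.
have /matrixP/(_ r 0) := eqM (tagnat.sig1 (cast_ord (esym sum_m) s))
  (tagnat.sig2 (cast_ord (esym sum_m) s)).
by rewrite /block_basis tagnat.sig2K cast_ordKV -!colE !mxE.
Qed.

Lemma castmx_mxrow_basis (a : nat) (B : forall i, 'M[R]_(a, m i)) i j :
  castmx (erefl, sum_m) (\mxrow_i B i) *m block_basis i j = col j (B i).
Proof.
rewrite /block_basis -colE; apply/matrixP => r s.
rewrite !mxE castmxE /= cast_ordK cast_ord_id.
by have /matrixP/(_ r j) := mxrowK B i; rewrite !mxE => ->.
Qed.

Lemma lagrange_X_basis i j : lagrange_X v sum_m *m block_basis i j = v i j.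
Proof.
rewrite castmx_mxrow_basis; apply/matrixP => r s.
by rewrite !mxE ord1.
Qed.

Lemma lagrange_block_basis i i' j :
  lagrange_block v sum_m i *m block_basis i' j = if i' == i then v i' j else 0.
Proof.
rewrite castmx_mxrow_basis; apply/matrixP => r s.
by case: eqP; rewrite !mxE ?ord1.
Qed.

Lemma lagrange_J_basis i j :
  lagrange_J x sum_m *m block_basis i j = x i *: block_basis i j.
Proof.
apply/matrixP => r s; rewrite -(cast_ordKV sum_m r).
rewrite -(tagnat.sig2K (cast_ord (esym sum_m) r)).
move: (tagnat.sig1 _) (tagnat.sig2 _) => i' j'.
rewrite /block_basis -colE !mxE castmxE /= !cast_ordK.
rewrite (inj_eq (@cast_ord_inj _ _ _)) -val_eqE /= tagnat.eq_Rank.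
(* [B] is the block family hidden in [\mxdiag], named so that [mxblockK] can read off one block. The
   [conform_mx] only reconciles the types: it is the identity once [a] and [b] coincide. *)
pose B a b : 'M[R]_(m a, m b) :=
  if a == b then conform_mx 0 ((x a)%:M : 'M_(m a)) else 0.
have /matrixP/(_ j' j) := mxblockK B i' i.
rewrite /mxdiag mxE => ->; rewrite {}/B ord1 eqxx andbT.
case: eqVneq => [ei|_]; last by rewrite mxE mulr0.
by case: i / ei j => j; rewrite conform_mx_id mxE mulr_natr -val_eqE.
Qed.

(** The basis vector is an eigenvector of [J] for [x i], so by induction [J ^+ l] scales it by
    [x i ^+ l]; then [X] sends it to [v i j]. *)
Lemma lagrange_XJ_basis l i j :
  lagrange_X v sum_m *m lagrange_J x sum_m ^+ l *m block_basis i j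
    = x i ^+ l *: v i j.
Proof.
rewrite -mulmxA; suff -> : lagrange_J x sum_m ^+ l *m block_basis i j
    = x i ^+ l *: block_basis i j.
  by rewrite -scalemxAr lagrange_X_basis.
elim: l => [|l IHl]; first by rewrite !expr0 mul1mx scale1r.
by rewrite !exprSr -mulmxA lagrange_J_basis -scalemxAr IHl scalerA mulrC.
Qed.

(** The block product is the sum over [l] of [A l *m X *m J ^+ l], and on an eigenvector of [J] each
    power of [J] becomes the same power of [x i]. *)
Lemma mxrow_lagrange_col_basis (A : 'I_n -> 'M[R]_p) i j :
  castmx (erefl, sum_const_ord n p) (\mxrow_l A l)
    *m lagrange_col x v sum_m *m block_basis i j
  = matpoly_eval (matpoly A) (x i) *m v i j.
Proof.
rewrite castmx_mul_inner mul_mxrow_mxcol matpoly_eval_matpoly !mulmx_suml.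
apply: eq_bigr => l _.
by rewrite -mulmxA lagrange_XJ_basis -scalemxAl -scalemxAr.
Qed.

(** Only the summand [i' = i] survives, since the other blocks vanish on this basis vector. *)
Lemma lagrange_interpolation_basis (F : R -> 'M[R]_p) i j :
  (\sum_(i' < k) F (x i') *m lagrange_block v sum_m i') *m block_basis i j
    = F (x i) *m v i j.
Proof.
rewrite mulmx_suml (bigD1 i) //= big1 => [|i' ne_i'i].
  by rewrite addr0 -mulmxA lagrange_block_basis eqxx.
by rewrite -mulmxA lagrange_block_basis eq_sym (negPf ne_i'i) mulmx0.
Qed.

End BlockBasis.

Theorem theorem4p2 (R : realType) (p n k : nat) (hp : (1 <= p)%N)
    (hn : (1 <= n)%N)
    (x : 'I_k -> R) (hx : injective x)
    (m : 'I_k -> nat) (hm : forall i : 'I_k, (1 <= m i)%N)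
    (sum_m : (\sum_(i < k) m i = n * p)%N)
    (v : forall i : 'I_k, 'I_(m i) -> 'cV[R]_p)
    (v_neq0 : forall (i : 'I_k) (j : 'I_(m i)), v i j != 0)
    (v_free : forall i : 'I_k, free [seq v i j | j : 'I_(m i)])
    (hcol : lagrange_col x v sum_m \in unitmx)
    (F : R -> 'M[R]_p) (P : 'M[{poly R}]_p) :
  is_lagrange_interpolant n x v F P <->
  P = \sum_(i < k) map_mx polyC (F (x i))
        *m map_mx polyC (lagrange_block v sum_m i)
        *m matpoly (lagrange_V x v sum_m).
Proof.
set W := \sum_(i < k) F (x i) *m lagrange_block v sum_m i.
(* The factors to the left of [matpoly] are constant in the variable, so they collect into [W] and
   multiply each coefficient. *)
have -> : \sum_(i < k) map_mx polyC (F (x i))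
    *m map_mx polyC (lagrange_block v sum_m i) *m matpoly (lagrange_V x v sum_m)
    = matpoly (fun l => W *m lagrange_V x v sum_m l).
  rewrite -mulmx_matpoly map_mx_sum mulmx_suml.
  by apply: eq_bigr => i _; rewrite map_mxM.
split=> [[[A ->] interpA]|->].
  have eqW : castmx (erefl, sum_const_ord n p) (\mxrow_l A l)
      *m lagrange_col x v sum_m = W.
    apply: (@mulmx_block_basis_inj _ _ _ _ _ sum_m) => i j.
    by rewrite mxrow_lagrange_col_basis interpA lagrange_interpolation_basis.
  (* [W *m lagrange_V x v sum_m l] is the [l]-th block of [W] times the inverse of [lagrange_col];
     replacing [W] by [eqW] cancels the inverse and leaves [A l]. *)
  apply: eq_matpoly => l; rewrite -eqW mul_submxrow.
  rewrite -castmx_row_mul mulmxK //.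
  by rewrite castmx_comp castmx_id mxrowK.
split; first by exists (fun l => W *m lagrange_V x v sum_m l).
(* Conversely, the row of these coefficients is [W] times the inverse, so multiplying by
   [lagrange_col] gives back [W]. *)
move=> i j; rewrite -mxrow_lagrange_col_basis -mul_mxrow castmx_row_mul.
by rewrite lagrange_VE mulmxKV // lagrange_interpolation_basis.
Qed.
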